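(* Let $(A,\mathfrak m,k)$ be a noetherian commutative local ring with maximal ideal $\mathfrak m$ and residue field $k$. Let $M$ be a complex of free $A$-modules with $M_i=0$ for $i\notin[0,\dim A]$, such that the $A$-module $\operatorname{H}_0(M)$ is finitely generated and $\operatorname{length}_A\operatorname{H}_i(M)$ is finite for each $i\ge 1$. Assume that $A$ has a big Cohen-Macaulay module. If $k$ is (isomorphic to) a direct summand of the $A$-module $\operatorname{H}_0(M)$, then the local ring $A$ is regular.
   Context: Complexes are graded homologically (the differential lowers degree by one). The free modules $M_i$ are not assumed to have finite rank. $\dim A$ denotes Krull dimension. For an $A$-module $C$ (not necessarily finitely generated), a sequence $x_1,\dots,x_n$ of elements of $A$ is $C$-regular if $(x_1,\dots,x_n)C\ne C$ and, for each $1\le i\le n$, $x_i$ is a non-zero divisor on $C/(x_1,\dots,x_{i-1})C$. An $A$-module $C$ (not necessarily finitely generated) is big Cohen-Macaulay if there is a system of parameters for $A$ that is $C$-regular. *)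

(* Defs.v *)
From HB Require Import structures.
From mathcomp Require Import all_boot all_order all_algebra.
From mathcomp Require Import boolp.

Set Implicit Arguments.
Unset Strict Implicit.
Unset Printing Implicit Defensive.

Import Order.TTheory GRing.Theory Num.Theory.
Local Open Scope ring_scope.
Local Open Scope quotient_scope.

(* Submodules and ideals are the library's boolean closed predicates
   ([submodClosed V], [idealr A], [prime_idealr A]); with the classical axioms
   of boolp these are all submodules, all proper ideals and all prime ideals. *)

Section ModuleQuotient.
Variables (A : pzRingType) (V : lmodType A) (S : submodClosed V).

Definition submod_pred : {pred V} := fun x => x \in S.

HB.instance Definition _ := GRing.isZmodClosed.Build V submod_pred
  (GRing.subsemimod_closedB (GRing.subsemimodClosedP S)).

Definition modquot : Type :=
  Quotient.quot (GRing.ZmodClosed.clone V submod_pred _).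

HB.instance Definition _ := GRing.Zmodule.on modquot.
HB.instance Definition _ := EqQuotient.on modquot.

Definition modquot_scale (a : A) (q : modquot) : modquot :=
  \pi_modquot (a *: repr q).

Lemma modquot_eqP (x y : V) :
  (x == y %[mod modquot]) = (x - y \in S).
Proof. by rewrite -Quotient.idealrBE. Qed.

Lemma pi_modquotD (x y : V) :
  \pi_modquot (x + y) = \pi_modquot x + \pi_modquot y.
Proof. by rewrite !piE. Qed.

Lemma pi_modquotZ a (x : V) :
  \pi_modquot (a *: x) = modquot_scale a (\pi_modquot x).
Proof.
apply/eqP; rewrite modquot_eqP -scalerBr rpredZ //.
by rewrite -modquot_eqP reprK.
Qed.

Lemma modquot_scaleA a b q :
  modquot_scale a (modquot_scale b q) = modquot_scale (a * b) q.
Proof.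
rewrite -[q]reprK; move: (repr q) => x.
by rewrite -(pi_modquotZ b x) -(pi_modquotZ a) -(pi_modquotZ _ x) scalerA.
Qed.

Lemma modquot_scale1 : left_id 1 modquot_scale.
Proof. by move=> q; rewrite /modquot_scale scale1r reprK. Qed.

Lemma modquot_scaleDr : right_distributive modquot_scale +%R.
Proof.
move=> a p q; rewrite -[p]reprK -[q]reprK; move: (repr p) (repr q) => x y.
rewrite -pi_modquotD -(pi_modquotZ a (x + y)) scalerDr pi_modquotD.
by rewrite (pi_modquotZ a x) (pi_modquotZ a y).
Qed.

Lemma modquot_scaleDl q : {morph modquot_scale^~ q : a b / a + b}.
Proof. by move=> a b; rewrite /modquot_scale scalerDl pi_modquotD. Qed.

HB.instance Definition _ := GRing.Zmodule_isLmodule.Build A modquot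
  modquot_scaleA modquot_scale1 modquot_scaleDr modquot_scaleDl.

End ModuleQuotient.

Section Homology.
Variables (A : pzRingType) (U V W : lmodType A).
Variables (f : {linear U -> V}) (g : {linear V -> W}).

Definition ker_pred : {pred V} := fun x => g x == 0.

Lemma ker_pred_closed : subsemimod_closed ker_pred.
Proof.
split; first split; rewrite ?unfold_in /ker_pred ?linear0 //.
- move=> x y; rewrite !unfold_in /ker_pred => /eqP gx /eqP gy.
  by rewrite linearD gx gy addr0.
- move=> a x; rewrite !unfold_in /ker_pred => /eqP gx.
  by rewrite linearZ_LR gx scaler0.
Qed.

HB.instance Definition _ := GRing.isSubmodClosed.Build A V ker_pred
  ker_pred_closed.

Record cycles := Cycle { cycle_val : V; _ : cycle_val \in ker_pred }.

HB.instance Definition _ := [isSub for cycle_val].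
HB.instance Definition _ := [Choice of cycles by <:].
HB.instance Definition _ := [SubChoice_isSubLmodule of cycles by <:].

Definition bound_pred : {pred cycles} := fun z => `[< exists u, f u = cycle_val z >].

Lemma bound_pred_closed : subsemimod_closed bound_pred.
Proof.
split; first split; rewrite ?unfold_in.
- by apply/asboolP; exists 0; rewrite linear0.
- move=> x y /asboolP[u ux] /asboolP[v vy].
  by apply/asboolP; exists (u + v); rewrite linearD ux vy.
- move=> a x /asboolP[u ux].
  by apply/asboolP; exists (a *: u); rewrite linearZ_LR ux.
Qed.

HB.instance Definition _ := GRing.isSubmodClosed.Build A cycles bound_pred
  bound_pred_closed.

Definition ker_mod_im : lmodType A := modquot (GRing.SubmodClosed.clone A cycles bound_pred _).

End Homology.

(* Homologically graded complexes: [diff i j] is the differential M_i -> M_j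
   when j = i - 1, and zero otherwise. *)
Record complex (A : pzRingType) := Complex {
  obj :> int -> lmodType A;
  diff : forall i j : int, {linear obj i -> obj j};
  diff_shape : forall i j, j != i - 1 -> forall x, diff i j x = 0;
  diff_diff : forall i j k x, diff j k (diff i j x) = 0
}.

Definition homology (A : pzRingType) (M : complex A) (i : int) : lmodType A :=
  ker_mod_im (diff M (i + 1) i) (diff M i (i - 1)).

Section Modules.
Variable A : pzRingType.
Implicit Types U V : lmodType A.

Definition lin_comb V (vs : seq V) (x : V) : Prop :=
  exists c : 'I_(size vs) -> A, x = \sum_i c i *: vs`_i.

Definition fin_gen V : Prop := exists vs : seq V, forall x, lin_comb vs x.

Definition is_basis V (B : V -> Prop) : Prop :=
  (forall x, exists vs : seq V, (forall v, v \in vs -> B v) /\ lin_comb vs x)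
  /\ (forall (vs : seq V) (c : V -> A), uniq vs -> (forall v, v \in vs -> B v) ->
        \sum_(v <- vs) c v *: v = 0 -> forall v, v \in vs -> c v = 0).

Definition is_free V : Prop := exists B : V -> Prop, is_basis B.

Definition strict_chain (T : Type) (n : nat) (P : nat -> {pred T}) : Prop :=
  forall i, (i < n)%N ->
    {subset P i <= P i.+1} /\ exists2 x, x \in P i.+1 & x \notin P i.

(* length V = sup of the lengths of the strict chains of submodules *)
Definition finite_length V : Prop :=
  exists n : nat, forall (l : nat) (S : nat -> submodClosed V),
    strict_chain l S -> (l <= n)%N.

Definition direct_summand U V : Prop :=
  exists (N : lmodType A) (f : {linear (U * N)%type -> V}), bijective f.

End Modules.

Section LocalRing.
Variable A : comNzRingType.

Definition noetherian : Prop := forall I : submodClosed A^o,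
  exists xs : seq A^o, forall a, a \in I <-> lin_comb xs a.

Definition krull_dim (d : nat) : Prop :=
  (exists P : nat -> prime_idealr A, strict_chain d P) /\
  (forall (n : nat) (P : nat -> prime_idealr A), strict_chain n P -> (n <= d)%N).

Definition maximal_ideal (m : idealr A) : Prop :=
  forall J : idealr A, {subset m <= J} -> J =i m.

Definition local_ring (m : idealr A) : Prop :=
  maximal_ideal m /\ forall n : idealr A, maximal_ideal n -> n =i m.

Definition ideal_pred (m : idealr A) : {pred A^o} := fun a => a \in m.

Lemma ideal_pred_closed m : subsemimod_closed (ideal_pred m).
Proof.
by split; [split; [exact: rpred0|exact: rpredD]|move=> a x; exact: idealMr].
Qed.

HB.instance Definition _ m := GRing.isSubmodClosed.Build A A^o (ideal_pred m)
  (ideal_pred_closed m).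

Definition residue_field (m : idealr A) : lmodType A :=
  modquot (GRing.SubmodClosed.clone A A^o (ideal_pred m) _).

Definition gen_ideal (xs : seq A) (a : A) : Prop := lin_comb (xs : seq A^o) a.

Definition system_of_parameters (m : idealr A) (xs : seq A) : Prop :=
  [/\ krull_dim (size xs),
      {subset xs <= m}
    & forall a, a \in m -> exists n : nat, gen_ideal xs (a ^+ n)].

Definition regular_local (m : idealr A) : Prop :=
  exists xs : seq A, krull_dim (size xs) /\ forall a, a \in m <-> gen_ideal xs a.

Section RegularSequence.
Variable C : lmodType A.

(* the submodule (x_1, ..., x_n)C = x_1 C + ... + x_n C *)
Definition ext_pred (xs : seq A) : {pred C} :=
  fun c => `[< exists v : 'I_(size xs) -> C, c = \sum_(i < size xs) xs`_i *: v i >].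

Lemma ext_pred_closed xs : subsemimod_closed (ext_pred xs).
Proof.
split; first split; rewrite ?unfold_in.
- by apply/asboolP; exists (fun=> 0); rewrite big1 // => i _; rewrite scaler0.
- move=> x y /asboolP[u ->] /asboolP[v ->]; apply/asboolP.
  exists (fun i => u i + v i); rewrite -big_split /=.
  by apply: eq_bigr => i _; rewrite scalerDr.
- move=> a x /asboolP[u ->]; apply/asboolP.
  exists (fun i => a *: u i); rewrite scaler_sumr.
  by apply: eq_bigr => i _; rewrite !scalerA mulrC.
Qed.

HB.instance Definition _ xs := GRing.isSubmodClosed.Build A C (ext_pred xs)
  (ext_pred_closed xs).

Definition nonzerodivisor (V : lmodType A) (a : A) : Prop :=
  forall v : V, a *: v = 0 -> v = 0.

Definition regular_sequence (xs : seq A) : Prop :=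
  (exists c, c \notin ext_pred xs) /\
  (forall i, (i < size xs)%N ->
     nonzerodivisor (modquot (GRing.SubmodClosed.clone A C (ext_pred (take i xs)) _)) xs`_i).

End RegularSequence.

Definition big_cohen_macaulay (m : idealr A) (C : lmodType A) : Prop :=
  exists xs : seq A, system_of_parameters m xs /\ regular_sequence C xs.

End LocalRing.

(* Main.v *)
Require Import Defs.
From HB Require Import structures.
From mathcomp Require Import all_boot all_order all_algebra.
From mathcomp Require Import boolp classical_sets functions.

Set Implicit Arguments.
Unset Strict Implicit.
Unset Printing Implicit Defensive.

Import Order.TTheory GRing.Theory Num.Theory.
Local Open Scope ring_scope.

(** Let y_1, ..., y_n be minimal generators of m; we show n <= dim A.  Write
    X = M (x) C, and for a system of parameters xs regular on C consider
    Y = Hom(K(xs^N), X), K the Koszul complex.  As X lives in degrees at most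
    dim A and xs^N is regular on every X_i, Y is exact in positive degrees.

    Let e in M_0 represent a generator of the summand k of H_0(M), and let
    d f_l = y_l e.  Since m acts nilpotently on H_i(M) for i >= 1, the element e
    and the f_l extend, for N large, to a chain map K(xs^N) -> M and
    null-homotopies of its multiples by the y_l.

    Tensored with c_1, ..., c_n in C such that sum y_l c_l = 0, these
    null-homotopies form a cycle in Y_1, hence a boundary, and the retraction
    H_0(M) -> k turns this into c_l in mC for all l (that is, Tor_1(k, C) = 0).

    Tensored with c in C \ mC, they extend, by exactness of Y, to a chain map
    K(y) -> Y -> X.  As in Serre's argument for regularity, if its value on the
    product of the first j + 1 generators lies in mX + dX then, the relations
    of the y_l on X having coefficients in mX, so does its value on the product
    of the first j; but its value e (x) c in degree 0 does not.  Hence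
    X_n <> 0 and n <= dim A. *)

(** * Koszul complexes as iterated cocones *)

Section ChainComplexes.
Variable A : comNzRingType.

(** There is no differential out of degree 0: only exactness in positive degrees matters, so
    negative degrees are cut off throughout. *)
Record chain := Chain {
  ob :> nat -> lmodType A;
  df : forall i, {linear ob i.+1 -> ob i};
  dfdf : forall i x, df i (df i.+1 x) = 0
}.
Arguments df {_ _}.
Implicit Types (X Y Z : chain) (x : A) (xs : seq A).

Definition exact_pos X :=
  forall i (z : X i.+1), df z = 0 -> exists w : X i.+2, z = df w.

Section Cocone.
Variables (x : A) (X : chain).

(** The differential of Hom(K(x), X); the two components are, up to sign, the values on the
    generators of K(x) in degrees 0 and 1. *)
Definition cocone_df i (z : (X i.+1 * X i.+2)%type) : (X i * X i.+1)%type :=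
  (df z.1, x *: z.1 - df z.2).

Lemma cocone_df_linear i : linear (@cocone_df i).
Proof.
move=> a [u v] [u' v']; rewrite /cocone_df /=; congr (_, _).
  by rewrite linearP.
by rewrite linearP /= scalerBr !scalerDr opprD addrACA !scalerA [x * a]mulrC.
Qed.

HB.instance Definition _ i := GRing.isLinear.Build A _ _ _ (@cocone_df i)
  (@cocone_df_linear i).

Lemma cocone_dfdf i z : @cocone_df i (@cocone_df i.+1 z) = 0.
Proof.
by rewrite /cocone_df /= linearB linearZ_LR /= !dfdf subr0 subrr.
Qed.

Definition cocone : chain := Chain cocone_dfdf.

Lemma cocone_exact_pos : exact_pos X -> exact_pos cocone.
Proof.
move=> exX i [a b] /= [] da /subr0_eq db; rewrite /= in a b da db *.
have [a' Ea] := exX _ _ da.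
have [|b' Eb] := exX _ (x *: a' - b).
  by rewrite linearB linearZ_LR -Ea db subrr.
by exists (a', b'); rewrite /= /cocone_df /= -Ea -Eb opprB addrC subrK.
Qed.

End Cocone.

(* The complex Hom(K(xs), X), K(xs) the Koszul complex, cut off below 0. *)
Fixpoint kos xs X : chain :=
  if xs is x :: xs' then kos xs' (cocone x X) else X.

(** Evaluation at the unit of K(xs) in degree 0. *)
Fixpoint kos_ev xs X i : kos xs X i -> X i :=
  match xs return kos xs X i -> X i with
  | [::] => id
  | x :: xs' => fun z => (@kos_ev xs' (cocone x X) i z).1
  end.

Lemma kos_ev_linear xs X i : linear (@kos_ev xs X i).
Proof. by elim: xs X => [|x xs IH] X a u v //=; rewrite IH. Qed.

HB.instance Definition _ xs X i := GRing.isLinear.Build A _ _ _ (@kos_ev xs X i)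
  (@kos_ev_linear xs X i).

Lemma kos_ev_df xs X i (z : kos xs X i.+1) : kos_ev (df z) = df (kos_ev z).
Proof. by elim: xs X z => [|x xs IH] X z //=; rewrite IH. Qed.

Section BilinearChainMap.
Variable C : lmodType A.

(** A chain map from M (x) C to X in bilinear form, so that it passes to Koszul complexes before any
    tensor product is built. *)
Record bilin (M X : chain) := Bilin {
  bl : forall i, M i -> C -> X i;
  bl_linearl : forall i c, linear (fun v => @bl i v c);
  bl_linearr : forall i v, linear (@bl i v);
  bl_df : forall i (v : M i.+1) c, df (bl v c) = bl (df v) c
}.

Lemma blZl M X (t : bilin M X) i a (v : M i) c : bl t (a *: v) c = a *: bl t v c.
Proof.
have t0 : bl t 0 c = 0 :> X i.
  have := bl_linearl t c 1 (0 : M i) 0; rewrite /= !scale1r addr0 => /eqP.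
  by rewrite -subr_eq0 opprD addNKr oppr_eq0 => /eqP.
by have := bl_linearl t c a v 0; rewrite /= addr0 t0 addr0.
Qed.

HB.instance Definition _ M X (t : bilin M X) i (v : M i) :=
  GRing.isLinear.Build A _ _ _ (bl t v) (bl_linearr t v).

Lemma cocone_bilin_subproof x M X (t : bilin M X) :
  let b i (z : cocone x M i) c := (bl t z.1 c, bl t z.2 c) : cocone x X i in
  [/\ forall i c, linear (fun v => b i v c), forall i v, linear (b i v)
    & forall i (v : cocone x M i.+1) c, df (b _ v c) = b _ (df v) c].
Proof.
move=> b; split=> [i c a u v|i v a c c'|i v c]; rewrite /b /=.
- by congr (_, _); rewrite bl_linearl.
- by congr (_, _); rewrite linearP.
rewrite /cocone_df /=; congr (_, _); rewrite ?bl_df //.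
have := bl_linearl t c (-1) (df v.2) (x *: v.1).
by rewrite /= !scaleN1r blZl addrC => <-; rewrite addrC.
Qed.

Definition cocone_bilin x M X (t : bilin M X) :
    bilin (cocone x M) (cocone x X) :=
  let: And3 p q r := cocone_bilin_subproof x t in Bilin p q r.

Fixpoint kos_bilin xs M X (t : bilin M X) : bilin (kos xs M) (kos xs X) :=
  match xs return bilin (kos xs M) (kos xs X) with
  | [::] => t
  | x :: xs' => kos_bilin xs' (cocone_bilin x t)
  end.

Lemma kos_ev_bilin xs M X (t : bilin M X) i (z : kos xs M i) c :
  kos_ev (bl (kos_bilin xs t) z c) = bl t (kos_ev z) c.
Proof.
elim: xs M X t z => [|x xs IH] M X t z //=; rewrite IH /cocone_bilin.
by case: cocone_bilin_subproof.
Qed.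

End BilinearChainMap.

(** * Complexes modulo subcomplexes *)

Section Relative.

(** A predicate: the complex X/S is studied by reading equations modulo S, without forming
    quotients. *)
Record subcomplex X := Subcomplex {
  sc :> forall i, X i -> Prop;
  sc0 : forall i, sc (0 : X i);
  scD : forall i (u v : X i), sc u -> sc v -> sc (u + v);
  scZ : forall i a (u : X i), sc u -> sc (a *: u);
  sc_df : forall i (u : X i.+1), sc u -> sc (df u)
}.

Lemma scN X (S : subcomplex X) i (u : X i) : S _ u -> S _ (- u).
Proof. by rewrite -scaleN1r; exact: scZ. Qed.

Lemma scB X (S : subcomplex X) i (u v : X i) : S _ u -> S _ v -> S _ (u - v).
Proof. by move=> Su Sv; apply: scD => //; exact: scN. Qed.

Lemma sc_subl X (S : subcomplex X) i (u v : X i) :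
  S _ (u - v) -> S _ u -> S _ v.
Proof. by move=> Suv Su; rewrite -(subKr u v); exact: scB. Qed.

Definition exact_mod X (S : subcomplex X) :=
  forall i (z : X i.+1), S _ (df z) -> exists w : X i.+2, S _ (z - df w).

Definition cocone_sc x X (S : subcomplex X) : subcomplex (cocone x X).
Proof.
apply: (@Subcomplex (cocone x X) (fun i z => S i z.1 /\ S i.+1 z.2)) => i.
- by split; exact: sc0.
- by move=> u v [? ?] [? ?]; split; exact: scD.
- by move=> a u [? ?]; split; exact: scZ.
by move=> u [? ?]; split; [exact: sc_df|apply: scB; [exact: scZ|exact: sc_df]].
Defined.

Fixpoint kos_sc xs X (S : subcomplex X) : subcomplex (kos xs X) :=
  match xs return subcomplex (kos xs X) with
  | [::] => S
  | x :: xs' => kos_sc xs' (cocone_sc x S)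
  end.

Lemma kos_sc_eq0 xs X (S : subcomplex X) :
  (forall i v, S i v -> v = 0) -> forall i v, kos_sc xs S i v -> v = 0.
Proof.
elim: xs X S => [|x xs IH] X S S0 //=; apply: IH => i [u v] /= [Su Sv].
by congr (_, _); exact: S0.
Qed.

(* A surjection whose kernel is exact in positive degrees, everything being
   read modulo the subcomplexes. *)
Record quasi_surj Y (S : subcomplex Y) Z (T : subcomplex Z) := QuasiSurj {
  qs :> forall i, {linear Y i -> Z i};
  qs_sc : forall i u, S i u -> T i (qs i u);
  qs_df : forall i (u : Y i.+1), T i (qs i (df u) - df (qs i.+1 u));
  qs_surj : forall i z, exists u, qs i u = z;
  qs_ker : forall i (z : Y i.+1), T _ (qs i.+1 z) -> S _ (df z) ->
    exists w : Y i.+2, T _ (qs i.+2 w) /\ S _ (z - df w)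
}.

(** Lift to Y a chain of Z that bounds the image of z modulo T; subtracting its boundary moves z
    into the kernel. *)
Lemma quasi_surj_exact Y (S : subcomplex Y) Z (T : subcomplex Z) :
  quasi_surj S T -> exact_mod T -> exact_mod S.
Proof.
move=> f exT i z Sdz.
have Tdz : T _ (df (f i.+1 z)) by apply: sc_subl (qs_df f z) _; exact: qs_sc.
have [w Tw] := exT _ _ Tdz; have [v fv] := qs_surj f w.
have Tzv : T _ (f i.+1 (z - df v)).
  have := scB Tw (qs_df f v); rewrite fv.
  by rewrite opprB addrA subrK -linearB.
have [|u [_ Su]] := qs_ker Tzv; first by rewrite linearB dfdf subr0.
by exists (v + u); rewrite linearD opprD addrA.
Qed.

End Relative.
End ChainComplexes.

Arguments df {_ _ _}.

(** * Weakly regular sequences *)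

Section WeaklyRegular.
Variable A : comNzRingType.
Implicit Types (V : lmodType A) (X Y Z : chain A) (x : A) (xs : seq A).

Definition adjoin V (S : V -> Prop) x : V -> Prop :=
  fun v => exists s w, S s /\ v = s + x *: w.

(* [xs] is a weakly regular sequence on V/S. *)
Fixpoint wreg V (S : V -> Prop) xs : Prop :=
  if xs is x :: xs' then
    (forall v, S (x *: v) -> S v) /\ wreg (adjoin S x) xs'
  else True.

(** The kernel of the induced map is the cocone of the kernel, and the argument of
    [cocone_exact_pos] applies to it modulo the subcomplexes. *)
Lemma cocone_quasi_surj x Y (S : subcomplex Y) Z (T : subcomplex Z) :
  quasi_surj S T -> quasi_surj (cocone_sc x S) (cocone_sc x T).
Proof.
move=> f.
pose g i (z : cocone x Y i) : cocone x Z i := (f i z.1, f i.+1 z.2).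
have g_lin i : linear (@g i) by move=> a u v; congr (_, _); rewrite linearP.
pose gL i := HB.pack_for {linear cocone x Y i -> cocone x Z i} (@g i)
  (GRing.isLinear.Build A _ _ _ (@g i) (g_lin i)).
apply: (@QuasiSurj _ _ (cocone_sc x S) _ (cocone_sc x T) gL).
- by move=> i u [? ?]; split; exact: qs_sc.
- move=> i [a b]; split; first exact: (qs_df f a).
  rewrite /= linearB linearZ_LR /= opprB addrC addrA subrK -opprB.
  exact/scN/(qs_df f b).
- move=> i [a b]; have [a' <-] := qs_surj f a; have [b' <-] := qs_surj f b.
  by exists (a', b').
move=> i [a b] [/= fa fb] [/= da dab].
have [a' [fa' Sa']] := @qs_ker _ _ _ _ _ f _ _ fa da.
have Sb : S _ (df (x *: a' - b)).
  rewrite linearB linearZ_LR /=; have := scB dab (scZ x Sa').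
  by rewrite scalerBr opprB addrAC addrCA subrr addr0.
have [|b' [fb' Sb']] := @qs_ker _ _ _ _ _ f _ _ _ Sb.
  by rewrite linearB linearZ_LR; apply: scB fb; exact: scZ.
exists (a', b'); split=> //; split=> //=.
by have := scN Sb'; rewrite !opprD !opprK addrA [- _ + b]addrC.
Qed.

Lemma kos_quasi_surj xs Y (S : subcomplex Y) Z (T : subcomplex Z) :
  quasi_surj S T -> quasi_surj (kos_sc xs S) (kos_sc xs T).
Proof.
by elim: xs Y S Z T => [|x xs IH] Y S Z T f //=; apply/IH/cocone_quasi_surj.
Qed.

Section ShiftQuotient.
Variables (x : A) (X : chain A) (S : subcomplex X).

Definition shift_df i (v : X i.+2) : X i.+1 := - df v.

Lemma shift_df_linear i : linear (@shift_df i).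
Proof. by move=> a u v; rewrite /shift_df linearP opprD scalerN. Qed.

HB.instance Definition _ i := GRing.isLinear.Build A _ _ _ (@shift_df i)
  (@shift_df_linear i).

Lemma shift_dfdf i v : @shift_df i (@shift_df i.+1 v) = 0.
Proof. by rewrite /shift_df linearN dfdf !oppr0. Qed.

Definition shift : chain A := Chain shift_dfdf.

Definition shift_sc : subcomplex shift.
Proof.
apply: (@Subcomplex _ shift (fun i => adjoin (S i.+1) x)) => i /=.
- by exists 0, 0; split; [exact: sc0|rewrite scaler0 addr0].
- move=> _ _ [s [w [Ss ->]]] [s' [w' [Ss' ->]]]; exists (s + s'), (w + w').
  by split; [exact: scD|rewrite scalerDr addrACA].
- move=> a _ [s [w [Ss ->]]]; exists (a *: s), (a *: w).
  by split; [exact: scZ|rewrite scalerDr !scalerA mulrC].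
move=> _ [s [w [Ss ->]]]; exists (- df s), (- df w).
split; first exact/scN/sc_df.
by rewrite /shift_df linearD linearZ_LR opprD scalerN.
Defined.

Hypothesis x_inj : forall i v, S i (x *: v) -> S i v.

(** As x is injective on X/S, the kernel of (a, b) -> b consists modulo S of the pairs (a, x b'),
    and (a, x b') -> (b', 0) contracts it. The projection commutes with the differentials only
    modulo x, whence the form of [qs_df]. *)
Lemma cocone_shift : quasi_surj (cocone_sc x S) shift_sc.
Proof.
pose g i (z : cocone x X i) : shift i := z.2.
have g_lin i : linear (@g i) by move=> a u v.
pose gL i := HB.pack_for {linear cocone x X i -> shift i} (@g i)
  (GRing.isLinear.Build A _ _ _ (@g i) (g_lin i)).
apply: (@QuasiSurj _ _ (cocone_sc x S) _ shift_sc gL) => i.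
- move=> [a b] [/= _ Sb]; exists b, 0.
  by rewrite scaler0 addr0.
- move=> [a b]; exists 0, a; split; first exact: sc0.
  by rewrite /= /shift_df opprK subrK add0r.
- by move=> z; exists (0, z).
move=> [a b] [s [b' [Ss /= ->]]] [/= da dab]; exists (b', 0); split.
  by exists 0, 0; split; [exact: sc0|rewrite scaler0 addr0].
split=> /=; last by rewrite linear0 subr0 addrK.
apply: x_inj; rewrite scalerBr -linearZ_LR /=; move: dab.
rewrite linearD opprD addrCA => /scD/(_ (sc_df Ss)).
by rewrite addrAC addNr add0r.
Qed.

End ShiftQuotient.

(** Each regular element x replaces X/S by X/(S + xX) shifted down by one, so the top degree drops
    along with the length of xs until nothing is left in positive degrees. *)
Lemma kos_exact_mod xs X (S : subcomplex X) :
  (forall i, wreg (S i) xs) -> (forall i v, (size xs < i)%N -> S i v) ->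
  exact_mod (kos_sc xs S).
Proof.
elim: xs X S => [|x xs IH] X S Sreg Sbig.
  by move=> i z _; exists 0; exact: Sbig.
apply: (@quasi_surj_exact _ _ _ _ (kos_sc xs (shift_sc x S))).
  by apply: (@kos_quasi_surj xs _ (cocone_sc x S));
    apply: cocone_shift => i v; exact: (Sreg i).1.
apply: IH => [i|i v lt_i]; first exact: (Sreg i.+1).2.
by exists v, 0; split; [exact: Sbig|rewrite scaler0 addr0].
Qed.

Definition sc_zero X : subcomplex X.
Proof.
apply: (@Subcomplex _ X (fun i v => v = 0)) => //.
- by move=> i u v -> ->; rewrite addr0.
- by move=> i a u ->; rewrite scaler0.
by move=> i u ->; rewrite linear0.
Defined.

Theorem kos_exact_pos xs X :
  (forall i, wreg (fun v : X i => v = 0) xs) ->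
  (forall i (v : X i), (size xs < i)%N -> v = 0) -> exact_pos (kos xs X).
Proof.
move=> Xreg X0 i z dz.
have := @kos_exact_mod xs X (sc_zero X) Xreg X0 i z.
rewrite dz => /(_ (sc0 _ _))[w /(kos_sc_eq0 _)/eqP].
by rewrite subr_eq0 => /(_ (fun _ _ => id))/eqP; exists w.
Qed.

Definition is_submod V (S : V -> Prop) : Prop :=
  [/\ S 0, forall u v, S u -> S v -> S (u + v) & forall a u, S u -> S (a *: u)].

Lemma is_submod_adjoin V (S : V -> Prop) x : is_submod S -> is_submod (adjoin S x).
Proof.
move=> [S0 SD SZ]; split.
- by exists 0, 0; split=> //; rewrite scaler0 addr0.
- move=> _ _ [s [w [Ss ->]]] [s' [w' [Ss' ->]]]; exists (s + s'), (w + w').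
  by split; [exact: SD|rewrite scalerDr addrACA].
move=> a _ [s [w [Ss ->]]]; exists (a *: s), (a *: w).
by split; [exact: SZ|rewrite scalerDr !scalerA mulrC].
Qed.

Lemma is_submodB V (S : V -> Prop) u v : is_submod S -> S u -> S v -> S (u - v).
Proof. by move=> [_ SD SZ] Su Sv; apply: SD => //; rewrite -scaleN1r; exact: SZ. Qed.

Lemma eq_wreg V (S T : V -> Prop) xs :
  (forall v, S v <-> T v) -> wreg S xs -> wreg T xs.
Proof. by move=> ST; have -> : S = T by apply/funext => v; exact/propext. Qed.

(* Weak regularity passes to the middle term of the short exact sequence
   0 -> U/R -> V/S -> V/T -> 0. *)
Lemma wreg_extension (U V : lmodType A) (j : {linear U -> V})
    (R : U -> Prop) (S T : V -> Prop) xs :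
  is_submod S -> (forall u, S (j u) <-> R u) ->
  (forall v, T v <-> exists s u, S s /\ v = s + j u) ->
  wreg R xs -> wreg T xs -> wreg S xs.
Proof.
elim: xs R S T => [|x xs IH] R S T subS SR TE //= [Rx Rxs] [Tx Txs].
have [S0 SD SZ] := subS.
have ST v : S v -> T v.
  by move=> Sv; apply/TE; exists v, 0; rewrite linear0 addr0.
split=> [v Sxv|].
  have /TE[s [u [Ss Ev]]] := Tx _ (ST _ Sxv).
  move: Sxv; rewrite Ev scalerDr => /(is_submodB subS)/(_ (SZ x _ Ss)).
  rewrite addrC addKr -linearZ_LR => /SR/Rx/SR; exact: SD.
apply: IH Rxs Txs; first exact: is_submod_adjoin.
- move=> u; split=> [[s [w [Ss Eu]]]|[r [w [Rr ->]]]]; last first.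
    by exists (j r), (j w); split; [exact/SR|rewrite linearD linearZ_LR].
  (* Regularity of x on V/T moves w into T; this keeps U/R -> V/S injective modulo x. *)
  have : T (x *: w).
    apply/TE; exists (- s), u; rewrite Eu addKr; split=> //.
    by rewrite -scaleN1r; exact: SZ.
  move=> /Tx/TE[s' [u' [Ss' Ew]]]; exists (u - x *: u'), u'.
  split; last by rewrite subrK.
  apply/SR; rewrite linearB linearZ_LR Eu Ew /= scalerDr addrA addrK.
  by apply: SD => //; exact: SZ.
move=> v; split=> [[s [w [/TE[s' [u [Ss' ->]]] ->]]]|[s [u [[s' [w [Ss' ->]]] ->]]]].
  exists (s' + x *: w), u; split; last by rewrite addrAC.
  by exists s', w.
exists (s' + j u), w; split; last by rewrite addrAC.
by apply/TE; exists s', u.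
Qed.

(** Induction on N through 0 -> V/(S + x^(N+1) V) -> V/(S + x^(N+2) V) -> V/(S + xV) -> 0, whose
    first map is multiplication by x. *)
Lemma wreg_adjoin_pow V (S : V -> Prop) x xs N :
  is_submod S -> (forall v, S (x *: v) -> S v) ->
  wreg (adjoin S x) xs -> wreg (adjoin S (x ^+ N.+1)) xs.
Proof.
move=> subS Sx Sxs; have [S0 SD SZ] := subS; elim: N => [|N IH] //.
apply: (@wreg_extension V V ( *:%R x) (adjoin S (x ^+ N.+1)) _ (adjoin S x)) => //.
- exact: is_submod_adjoin.
- move=> u; split=> [[s [w [Ss Eu]]]|[s [w [Ss ->]]]].
    exists (u - x ^+ N.+1 *: w), w; split; last by rewrite subrK.
    by apply: Sx; rewrite scalerBr scalerA -exprS Eu addrK.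
  exists (x *: s), w; split; first exact: SZ.
  by rewrite /= scalerDr scalerA -exprS.
move=> v; split=> [[s [w [Ss ->]]]|[_ [u [[s [w [Ss ->]]] ->]]]].
  exists s, w; split=> //; exists s, 0; split=> //; by rewrite scaler0 addr0.
exists s, (x ^+ N.+1 *: w + u); split=> //.
by rewrite scalerDr scalerA -exprS addrA.
Qed.

(** Each element has its own exponent because [kos_lift] finds them one at a time. *)
Fixpoint pow_seq xs (Ns : seq nat) : seq A :=
  if (xs, Ns) is (x :: xs', N :: Ns') then x ^+ N.+1 :: pow_seq xs' Ns' else [::].

Lemma size_pow_seq xs Ns : size Ns = size xs -> size (pow_seq xs Ns) = size xs.
Proof. by elim: xs Ns => [|x xs IH] [|N Ns] //= [/IH ->]. Qed.

Lemma wreg_pow V (S : V -> Prop) xs Ns :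
  is_submod S -> wreg S xs -> wreg S (pow_seq xs Ns).
Proof.
elim: xs Ns S => [|x xs IH] [|N Ns] S subS //= [Sx Sxs]; split.
  elim: N => [|N IHN] v; first by rewrite expr1; exact: Sx.
  by rewrite exprS -scalerA => /Sx/IHN.
apply: IH; first exact: is_submod_adjoin.
exact: wreg_adjoin_pow.
Qed.

End WeaklyRegular.

(** * Lifting along Koszul complexes *)

Lemma sum_delta (A : comNzRingType) n (y : 'I_n -> A) k :
  exists c, y k = \sum_l c l * y l.
Proof.
exists (fun l => (l == k)%:R); rewrite (bigD1 k) //= eqxx mul1r.
by rewrite big1 ?addr0 // => l /negPf ->; rewrite mul0r.
Qed.

Section KoszulLifting.
Variables (A : comNzRingType) (n : nat) (y : 'I_n -> A).
Implicit Types (X : chain A) (x : A) (xs : seq A).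

(** What is retained of finite length in positive degrees: unlike a bound on lengths, it passes to
    cocones by a direct computation. *)
Definition nilp_homology X x := forall i, exists N, forall z : X i.+1,
  df z = 0 -> exists w : X i.+2, x ^+ N *: z = df w.

(** In H_{i+2}(X) -> H_{i+1}(cocone) -> H_{i+1}(X), exact in the middle, the two outer exponents add
    up. *)
Lemma cocone_nilp_homology X x x' :
  nilp_homology X x -> nilp_homology (cocone x' X) x.
Proof.
move=> nilX i; have [N xN] := nilX i; have [N' xN'] := nilX i.+1.
exists (N' + N)%N => -[a b] [/= da /subr0_eq dab].
have [a' Ea'] := xN _ da.
have [|b' Eb'] := xN' (x ^+ N *: b - x' *: a').
  by rewrite linearB !linearZ_LR /= -dab -Ea' scalerN !scalerA mulrC subrr.
exists (x ^+ N' *: a', - b'); congr (_, _).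
  by rewrite /= linearZ_LR -Ea' scalerA exprD.
rewrite /= linearN opprK -Eb' scalerBr !scalerA -exprD [x' * _]mulrC.
by rewrite addrC subrK.
Qed.

(** With f' = sum a_l f_l one has d f' = x e, and x f_l - y_l f' is a cycle, made a boundary by x^N;
    hence the exponent N + 1. The pair (e, x^N f') extends e to K(x^(N+1)). *)
Lemma cocone_lift X (e : X 0%N) (f : 'I_n -> X 1%N) (a : 'I_n -> A) x N :
  (forall l, df (f l) = y l *: e) -> x = \sum_l a l * y l ->
  (forall z : X 1%N, df z = 0 -> exists w : X 2%N, x ^+ N *: z = df w) ->
  exists (e' : cocone (x ^+ N.+1) X 0%N) (g : 'I_n -> cocone (x ^+ N.+1) X 1%N),
  [/\ e'.1 = e, df e'.2 = x ^+ N.+1 *: e, forall l, (g l).1 = f l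
    & forall l, df (g l) = y l *: e'].
Proof.
move=> df_f Ex nil; pose f' := \sum_l a l *: f l.
have df_f' : df f' = x *: e.
  rewrite linear_sum Ex scaler_suml; apply: eq_bigr => l _.
  by rewrite linearZ_LR /= df_f scalerA.
have /choice[w Ew] l : exists w : X 2%N, x ^+ N *: (x *: f l - y l *: f') = df w.
  apply: nil; rewrite linearB !linearZ_LR /= df_f df_f'.
  by rewrite scalerN !scalerA mulrC subrr.
exists (e, x ^+ N *: f'), (fun l => (f l, w l)); split=> //=.
  by rewrite linearZ_LR /= df_f' scalerA exprSr.
move=> l; rewrite /cocone_df /= df_f -Ew; congr (_, _).
by rewrite scalerBr !scalerA -exprSr subKr mulrC.
Qed.

(** Iterates [cocone_lift]; nilpotency passes to the cocone whatever exponent was used to form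
    it. *)
Lemma kos_lift xs X (e : X 0%N) (f : 'I_n -> X 1%N) :
  (forall l, df (f l) = y l *: e) ->
  (forall x, x \in xs -> exists a, x = \sum_(l < n) a l * y l) ->
  (forall x, x \in xs -> nilp_homology X x) ->
  exists2 Ns, size Ns = size xs &
    exists (p : kos (pow_seq xs Ns) X 0%N) (s : 'I_n -> kos (pow_seq xs Ns) X 1%N),
    [/\ kos_ev p = e, forall l, kos_ev (s l) = f l
      & forall l, df (s l) = y l *: p].
Proof.
elim: xs X e f => [|x xs IH] X e f df_f gen_xs nil_xs.
  by exists [::] => //; exists e, f.
have [a Ex] := gen_xs x (mem_head _ _).
have [N xN] := nil_xs x (mem_head _ _) 0%N.
have [e' [g [e'1 _ g1 dg]]] := cocone_lift df_f Ex xN.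
have [x' xs_x'|x' xs_x'|Ns sz_Ns [p [s [evp evs ds]]]] := IH _ e' g dg.
- by apply: gen_xs; rewrite inE xs_x' orbT.
- by apply/cocone_nilp_homology/nil_xs; rewrite inE xs_x' orbT.
exists (N :: Ns); first by rewrite /= sz_Ns.
by exists p, s; split=> //= [|l]; rewrite (evp, evs).
Qed.

(* The elements [p j] are the values, up to sign, of a chain map K(y) -> X on
   the products of the first j generators listed in [s]. *)
Lemma koszul_ladder (s : seq 'I_n) X (e : X 0%N) (f : 'I_n -> X 1%N) :
  uniq s -> exact_pos X -> (forall l, df (f l) = y l *: e) ->
  exists p : forall j, X j, p 0%N = e /\
  forall j l, (j < size s)%N -> nth l s j = l -> exists c (u : 'I_n -> X j),
  [/\ c * c = 1, u l = 0 & df (p j.+1) = (c * y l) *: p j + \sum_i y i *: u i].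
Proof.
elim: s X e f => [|k s IH] X e f /=.
  by move=> _ _ _; exists (fun j => if j is 0%N then e else 0).
move=> /andP[ks uniq_s] exX df_f.
have [a Ey] := sum_delta y k.
(* As X is exact, [cocone_lift] applies with N = 0. *)
have nil (z : X 1%N) : df z = 0 -> exists w : X 2%N, y k ^+ 0 *: z = df w.
  by move=> /exX[w Ez]; exists w; rewrite scale1r.
have [e' [g [e'1 e'2 g1 dg]]] := cocone_lift df_f Ey nil.
have [P [P0 PS]] := IH _ e' g uniq_s (cocone_exact_pos exX) dg.
(* Products that contain the first generator k are read off the second components of the ladder in
   the cocone. *)
exists (fun j => if j is j'.+1 then (P j').2 else e); split=> // -[|j] l /=.
  move=> _ <-; exists 1, (fun=> 0); split=> //; first by rewrite mulr1.
  by rewrite P0 e'2 mul1r expr1 big1 ?addr0 // => i _; rewrite scaler0.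
rewrite ltnS => lt_j nth_l; have [c [u [cc ul dP]]] := PS j l lt_j nth_l.
have /eqP := congr1 snd dP; rewrite /= subr_eq addrC -subr_eq => /eqP dP2.
(* The second component of a boundary is y_k a - d b: this flips the sign c and adds a to the
   coefficient at k, which differs from l since the list has no repetition. *)
exists (- c), (fun i => (i == k)%:R *: (P j.+1).1 - (u i).2); split.
- by rewrite mulrNN.
- rewrite ul subr0 -nth_l; case: eqP => [lk|]; last by rewrite scale0r.
  by rewrite -lk mem_nth in ks.
rewrite -dP2 expr1 opprD addrCA -scaleNr mulNr; congr (_ + _).
apply/esym; under eq_bigr do rewrite scalerBr.
rewrite sumrB [(\sum_(i < n) _).2](raddf_sum snd) /=; congr (_ - _).
rewrite (bigD1 k) //= eqxx scale1r big1 ?addr0 // => i /negPf ->.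
by rewrite scale0r scaler0.
Qed.

End KoszulLifting.

(** * Tensor products with free modules *)

Section FinitelySupported.
Variables (A : comNzRingType) (B : choiceType) (C : lmodType A).

(** The direct sum of copies of C over B: it serves as V (x) C for V free on B, and as V itself when
    C is A. *)
Definition finsupp_pred : {pred B -> C} :=
  fun w => `[< exists s : seq B, forall b, b \notin s -> w b = 0 >].

Lemma finsupp_pred_closed : subsemimod_closed finsupp_pred.
Proof.
split; first split; rewrite ?unfold_in.
- by apply/asboolP; exists [::].
- move=> u v /asboolP[s us] /asboolP[s' vs']; apply/asboolP; exists (s ++ s').
  move=> b; rewrite mem_cat => /norP[/us ub /vs' vb].
  by rewrite addrfctE ub vb addr0.
move=> a u /asboolP[s us]; apply/asboolP; exists s => b /us ub.
by rewrite scalrfctE ub scaler0.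
Qed.

HB.instance Definition _ := GRing.isSubmodClosed.Build A (B -> C) finsupp_pred
  finsupp_pred_closed.

Record finsupp := Finsupp { fs_val :> B -> C; _ : fs_val \in finsupp_pred }.

HB.instance Definition _ := [isSub for fs_val].
HB.instance Definition _ := [Choice of finsupp by <:].
HB.instance Definition _ := [SubChoice_isSubLmodule of finsupp by <:].

Implicit Types w : finsupp.

Lemma fsP w w' : (forall b, w b = w' b) -> w = w'.
Proof. by move=> ww'; apply/val_inj/funext. Qed.

Lemma fs0E b : (0 : finsupp) b = 0. Proof. by []. Qed.
Lemma fsDE w w' b : (w + w') b = w b + w' b. Proof. by []. Qed.
Lemma fsZE a w b : (a *: w) b = a *: w b. Proof. by []. Qed.

Lemma fs_sumE (I : Type) (r : seq I) (P : pred I) (F : I -> finsupp) b :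
  (\sum_(i <- r | P i) F i) b = \sum_(i <- r | P i) F i b.
Proof.
exact: (big_morph (fun w : finsupp => w b) (fun _ _ => fsDE _ _ _) (fs0E b)).
Qed.

Lemma fs_supp w : {s : seq B | uniq s & forall b, b \notin s -> w b = 0}.
Proof.
have /asboolP/cid[s sP] := valP w; exists (undup s); first exact: undup_uniq.
by move=> b; rewrite mem_undup; exact: sP.
Qed.

Definition supp w : seq B := s2val (fs_supp w).
Lemma supp_uniq w : uniq (supp w). Proof. exact: (s2valP (fs_supp w)). Qed.
Lemma suppP w b : b \notin supp w -> w b = 0.
Proof. exact: (s2valP' (fs_supp w)). Qed.

Definition mk_fs (s : seq B) (u : B -> C) : finsupp :=
  insubd 0 (fun b => if b \in s then u b else 0).

Lemma mk_fsE s u b : mk_fs s u b = if b \in s then u b else 0.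
Proof.
rewrite /mk_fs insubdK //; apply/asboolP; exists s => b' /negPf.
by move=> ->.
Qed.

Section Extension.
Variables (U : lmodType A) (h : B -> C -> U).
Hypothesis h_linear : forall b, linear (h b).

Definition fs_ext w : U := \sum_(b <- supp w) h b (w b).

Let h0 b : h b 0 = 0.
Proof.
by have := h_linear b (-1) 0 0; rewrite scaleN1r oppr0 addr0 scaleN1r addNr.
Qed.

(** Both sums reduce to the b with w b <> 0, as each h b vanishes at 0; the choice of support list
    becomes irrelevant. *)
Lemma fs_extE w s : uniq s -> (forall b, b \notin s -> w b = 0) ->
  fs_ext w = \sum_(b <- s) h b (w b).
Proof.
move=> us sP.
have E r : \sum_(b <- r) h b (w b) = \sum_(b <- [seq b <- r | w b != 0]) h b (w b).
  rewrite big_filter [RHS]big_mkcond /=; apply: eq_bigr => b _.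
  by case: eqP => //= ->.
rewrite /fs_ext E [RHS]E; apply: perm_big; apply: uniq_perm.
- exact/filter_uniq/supp_uniq.
- exact: filter_uniq.
move=> b; rewrite !mem_filter; case: eqP => //= wb.
by apply/idP/idP => _; apply: contra_notT wb; [exact: sP|exact: suppP].
Qed.

Lemma fs_ext_linear : linear fs_ext.
Proof.
move=> a u v; pose s := undup (supp u ++ supp v).
have sP w : {subset supp w <= s} -> forall b, b \notin s -> w b = 0.
  by move=> ws b bs; apply: suppP; apply: contra bs; exact: ws.
have su : {subset supp u <= s} by move=> b; rewrite mem_undup mem_cat => ->.
have sv : {subset supp v <= s} by move=> b; rewrite mem_undup mem_cat orbC => ->.
rewrite !(@fs_extE _ s) ?undup_uniq //; try exact: sP.
  by rewrite scaler_sumr -big_split /=; apply: eq_bigr => b _; rewrite h_linear.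
by move=> b bs; rewrite fsDE fsZE (sP u) // (sP v) // scaler0 addr0.
Qed.

Lemma fs_ext1 b c : fs_ext (mk_fs [:: b] (fun=> c)) = h b c.
Proof.
rewrite (@fs_extE _ [:: b]) // => [|b' b'b].
  by rewrite big_seq1 mk_fsE mem_head.
by rewrite mk_fsE (negPf b'b).
Qed.

End Extension.

(** Adjoining x commutes with the direct sum: decompositions are chosen coordinate by coordinate, on
    the support only. *)
Lemma fs_wreg (S : C -> Prop) xs :
  is_submod S -> wreg S xs -> wreg (fun w => forall b, S (w b)) xs.
Proof.
elim: xs S => [|x xs IH] S subS //= [Sx Sxs]; have [S0 SD SZ] := subS; split.
  by move=> w Sw b; apply: Sx; exact: Sw.
apply: eq_wreg (IH _ (is_submod_adjoin x subS) Sxs) => w.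
split=> [Sw|[s [u [Ss ->]]] b]; last by exists (s b), (u b).
have /choice[s /choice[u Esu]] := Sw.
exists (mk_fs (supp w) s), (mk_fs (supp w) u); split.
  by move=> b; rewrite mk_fsE; case: ifP => // _; exact: (Esu b).1.
apply: fsP => b; rewrite fsDE fsZE !mk_fsE.
case: ifPn => [_|/suppP]; first exact: (Esu b).2.
by rewrite scaler0 addr0.
Qed.

Lemma fs_relations n (y : 'I_n -> A) (v : 'I_n -> finsupp) :
  (forall c : 'I_n -> C, \sum_i y i *: c i = 0 ->
     forall l, exists u, c l = \sum_i y i *: u i) ->
  \sum_i y i *: v i = 0 -> forall l, exists u, v l = \sum_i y i *: u i.
Proof.
move=> yC Ev l.
have /choice[u Eu] b : exists u : 'I_n -> C, v l b = \sum_i y i *: u i.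
  apply: (yC (fun i => v i b)); rewrite -[RHS](fs0E b) -Ev fs_sumE.
  exact: eq_bigr.
exists (fun i => mk_fs (supp (v l)) (fun b => u b i)); apply: fsP => b.
rewrite fs_sumE; case: (boolP (b \in supp (v l))) => vb.
  by rewrite Eu; apply: eq_bigr => i _; rewrite fsZE mk_fsE vb.
by rewrite suppP // big1 // => i _; rewrite fsZE mk_fsE (negPf vb) scaler0.
Qed.

End FinitelySupported.

Section FreeModule.
Variables (A : comNzRingType) (V : lmodType A) (basis : V -> Prop).
Hypothesis basisP : is_basis basis.

Definition bidx := {b : V | `[< basis b >]}.
HB.instance Definition _ := Choice.on bidx.

Let expand : finsupp bidx A^o -> V := fs_ext (fun b (a : A^o) => a *: val b).

Let expand_linear : linear expand.
Proof.
by apply: fs_ext_linear => b a c c'; rewrite scalerDl -scalerA.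
Qed.

Let expand_inj w : expand w = 0 -> w = 0.
Proof.
move=> Ew; apply: fsP => b; rewrite fs0E.
have [bw|] := boolP (b \in supp w); last exact: suppP.
(* Independence is stated with coefficients on all of V, so w is extended by zero off the basis. *)
pose c v : A := if insub v is Some b' then w b' else 0.
have cE b' : c (val b') = w b' by rewrite /c valK.
rewrite -cE; apply: (basisP.2 [seq val b | b <- supp w]).
- by rewrite map_inj_uniq ?supp_uniq //; exact: val_inj.
- by move=> _ /mapP[b' _ ->]; exact/asboolP/(valP b').
- by rewrite -[RHS]Ew big_map; apply: eq_bigr => b' _; rewrite cE.
exact: map_f.
Qed.

Let expand_surj v : exists w, expand w = v.
Proof.
have [vs [vs_basis [c ->]]] := basisP.1 v.
pose bi (i : 'I_(size vs)) : bidx :=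
  exist _ vs`_i (asboolT (vs_basis _ (mem_nth 0 (ltn_ord i)))).
pose L := HB.pack_for {linear finsupp bidx A^o -> V} expand
  (GRing.isLinear.Build A _ _ _ expand expand_linear).
exists (\sum_i mk_fs [:: bi i] (fun=> c i : A^o)).
rewrite -[expand]/(L : _ -> _) linear_sum; apply: eq_bigr => i _.
by rewrite /= /expand fs_ext1 // => b a u u'; rewrite scalerDl -scalerA.
Qed.

(** A chosen preimage under [expand]; injectivity of [expand] makes the choice linear. *)
Definition fcoord v : finsupp bidx A^o := sval (cid (expand_surj v)).

Lemma fcoordE v : v = \sum_(b <- supp (fcoord v)) (fcoord v b : A) *: val b.
Proof. exact/esym/(svalP (cid (expand_surj v))). Qed.

Lemma fcoord_linear : linear fcoord.
Proof.
move=> a u v; apply/eqP; rewrite -subr_eq0; apply/eqP/expand_inj.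
pose L := HB.pack_for {linear finsupp bidx A^o -> V} expand
  (GRing.isLinear.Build A _ _ _ expand expand_linear).
rewrite -[expand]/(L : _ -> _) linearB linearP.
have coordK w : L (fcoord w) = w by exact: (svalP (cid (expand_surj w))).
by rewrite !coordK subrr.
Qed.

Section Tensor.
Variable C : lmodType A.

Definition tens v (c : C) : finsupp bidx C :=
  mk_fs (supp (fcoord v)) (fun b => (fcoord v b : A) *: c).

Lemma tensE v c b : tens v c b = (fcoord v b : A) *: c.
Proof. by rewrite mk_fsE; case: ifPn => // /suppP ->; rewrite scale0r. Qed.

Lemma tens_linearl c : linear (tens^~ c).
Proof.
move=> a u v; apply: fsP => b; rewrite fsDE fsZE !tensE fcoord_linear.
by rewrite fsDE fsZE scalerDl scalerA.
Qed.

Lemma tens_linearr v : linear (tens v).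
Proof.
move=> a c c'; apply: fsP => b; rewrite fsDE fsZE !tensE.
by rewrite scalerDr !scalerA mulrC.
Qed.

Section Extension.
Variables (U : lmodType A) (h : V -> C -> U).
Hypotheses (h_linl : forall c, linear (h^~ c)) (h_linr : forall v, linear (h v)).

Definition tens_ext : finsupp bidx C -> U := fs_ext (fun b => h (val b)).

Lemma tens_ext_linear : linear tens_ext.
Proof. by apply: fs_ext_linear => b; exact: h_linr. Qed.

(** Universal property of the tensor product: [tens_ext] uses h on basis elements only, and
    linearity in v recovers the rest. *)
Lemma tens_extE v c : tens_ext (tens v c) = h v c.
Proof.
pose hL c := HB.pack_for {linear V -> U} (h^~ c)
  (GRing.isLinear.Build A _ _ _ (h^~ c) (h_linl c)).
pose hR v := HB.pack_for {linear C -> U} (h v)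
  (GRing.isLinear.Build A _ _ _ (h v) (h_linr v)).
rewrite /tens_ext (@fs_extE _ _ _ _ _ _ _ (supp (fcoord v))) ?supp_uniq //.
- rewrite [in RHS](fcoordE v) -[h^~ c _]/(hL c _) linear_sum.
  apply: eq_bigr => b _; rewrite tensE -[h _ _]/(hR _ _).
  by rewrite !linearZ_LR.
by move=> b /suppP vb; rewrite tensE vb scale0r.
Qed.

End Extension.
End Tensor.
End FreeModule.

(** Projectivity of free modules. Only the image of q has to lie in that of p, which allows lifts
    along A^n -> A with values in m. *)
Lemma free_lift (A : comNzRingType) (V U W : lmodType A)
    (p : {linear U -> W}) (q : {linear V -> W}) :
  is_free V -> (forall v, exists u, p u = q v) ->
  exists g : {linear V -> U}, forall v, p (g v) = q v.
Proof.
move=> [basis basisP] /choice[g0 pg0].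
pose h (b : bidx basis) (a : A^o) := a *: g0 (val b).
have h_lin b : linear (h b) by move=> a c c'; rewrite /h scalerDl -scalerA.
pose g v := fs_ext h (fcoord basisP v).
have g_lin : linear g by move=> a u v; rewrite /g fcoord_linear fs_ext_linear.
pose gL := HB.pack_for {linear V -> U} g (GRing.isLinear.Build A _ _ _ g g_lin).
exists gL => v; rewrite /= /g /fs_ext [in RHS](fcoordE basisP v) !linear_sum.
by apply: eq_bigr => b _; rewrite /h !linearZ_LR /= pg0.
Qed.

(** A basis of the zero module is empty, as 1 <> 0 in A. Thus M_i = 0 gives (M (x) C)_i = 0. *)
Lemma basis_of_trivial (A : comNzRingType) (V : lmodType A) (basis : V -> Prop)
    (C : lmodType A) (w : finsupp (bidx basis) C) :
  is_basis basis -> (forall v : V, v = 0) -> w = 0.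
Proof.
move=> basisP V0; apply: fsP => b.
have bb : basis (val b) by exact/asboolP/(valP b).
have mem_b v : v \in [:: val b] -> basis v by rewrite inE => /eqP ->.
have := basisP.2 [:: val b] (fun=> 1) isT mem_b (V0 _) (val b) (mem_head _ _).
by move=> /eqP; rewrite oner_eq0.
Qed.

Section TensorComplex.
Variables (A : comNzRingType) (M : chain A) (basis : forall i, M i -> Prop).
Hypothesis basisP : forall i, is_basis (@basis i).
Variable C : lmodType A.

Let T i : lmodType A := finsupp (bidx (@basis i)) C.
Let tn i (v : M i) (c : C) : T i := tens (@basisP i) v c.

Definition tens_df i : T i.+1 -> T i := tens_ext (fun v c => tn (df v) c).

Let tn_df_linl i c : linear (fun v : M i.+1 => tn (df v) c).
Proof. by move=> a u v; rewrite /= linearP; exact: tens_linearl. Qed.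

Let tn_df_linr i (v : M i.+1) : linear (tn (df v)).
Proof. exact: tens_linearr. Qed.

Lemma tens_df_linear i : linear (@tens_df i).
Proof. by apply: tens_ext_linear => v; exact: tn_df_linr. Qed.

HB.instance Definition _ i := GRing.isLinear.Build A _ _ _ (@tens_df i)
  (@tens_df_linear i).

Lemma tens_dfE i (v : M i.+1) c : tens_df (tn v c) = tn (df v) c.
Proof.
apply: (tens_extE (basisP i.+1) (h := fun v c => tn (df v) c)).
- exact: tn_df_linl.
- exact: tn_df_linr.
Qed.

Lemma tens_dfdf i w : @tens_df i (@tens_df i.+1 w) = 0.
Proof.
rewrite [in X in tens_df X]/tens_df /tens_ext /fs_ext linear_sum big1 // => b _.
rewrite /= tens_dfE dfdf /tn.
have := @tens_linearl _ _ _ (basisP i) C (w b) (-1) 0 0.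
by rewrite scaleN1r oppr0 addr0 scaleN1r addNr.
Qed.

Definition tens_chain : chain A := Chain tens_dfdf.

Definition tens_bilin : bilin C M tens_chain :=
  @Bilin _ C M tens_chain tn (fun i => tens_linearl (basisP i) (C := C))
    (fun i => tens_linearr (basisP i) (C := C)) tens_dfE.

End TensorComplex.

(** * The bound on the embedding dimension *)

Section EmbeddingDimension.
Variables (A : comNzRingType) (m : idealr A) (n : nat) (y : 'I_n -> A).
Hypothesis m_gen : forall a, a \in m -> exists c, a = \sum_l c l * y l.
Hypothesis y_min : forall a : 'I_n -> A,
  \sum_l a l * y l = 0 -> forall l, a l \in m.

Definition in_mV (V : lmodType A) (v : V) := exists u, v = \sum_l y l *: u l.

Lemma in_mV_submod V : is_submod (@in_mV V).
Proof.
split.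
- by exists (fun=> 0); rewrite big1 // => l _; rewrite scaler0.
- move=> _ _ [u ->] [v ->]; exists (fun l => u l + v l).
  by rewrite -big_split; apply: eq_bigr => l _; rewrite scalerDr.
move=> a _ [u ->]; exists (fun l => a *: u l); rewrite scaler_sumr.
by apply: eq_bigr => l _; rewrite !scalerA mulrC.
Qed.

Lemma in_mVZ (V : lmodType A) a (v : V) : a \in m -> in_mV (a *: v).
Proof.
move=> /m_gen[c ->]; exists (fun l => c l *: v); rewrite scaler_suml.
by apply: eq_bigr => l _; rewrite scalerA mulrC.
Qed.

Lemma in_mV_sum (V : lmodType A) (I : Type) (s : seq I) (F : I -> V) :
  (forall i, in_mV (F i)) -> in_mV (\sum_(i <- s) F i).
Proof.
have [V0 VD _] := in_mV_submod V.
by move=> mF; apply: big_ind => //.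
Qed.

Variables (M : chain A) (basis : forall i, M i -> Prop).
Hypothesis basisP : forall i, is_basis (@basis i).
Variables (e : M 0%N) (f : 'I_n -> M 1%N).
Hypothesis df_f : forall l, df (f l) = y l *: e.
(** A lift to A of the retraction H_0(M) -> k. *)
Variable r : {linear M 0%N -> A^o}.
Hypothesis r_e : (r e : A) - 1 \in m.
Hypothesis r_df : forall v, (r (df v) : A) \in m.
Hypothesis nilM : forall x, x \in m -> nilp_homology M x.
Variables (C : lmodType A) (xs : seq A).
Hypothesis xs_m : forall x, x \in xs -> x \in m.
Hypothesis C_reg : wreg (fun c : C => c = 0) xs.
Hypothesis M_big : forall i (v : M i), (size xs < i)%N -> v = 0.

Let X := tens_chain basisP C.
Let t : bilin C M X := tens_bilin basisP C.

Section Functional.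
Variables (i : nat) (g : {linear M i -> A^o}).

(** The map g (x) C, with A (x) C identified with C. *)
Definition tens_fun (w : X i) : C := tens_ext (fun v c => (g v : A) *: c) w.

Lemma tens_fun_linear : linear tens_fun.
Proof.
have h_linr (v : M i) : linear (fun c : C => (g v : A) *: c).
  by move=> a c c'; rewrite scalerDr !scalerA mulrC.
exact: tens_ext_linear h_linr.
Qed.

HB.instance Definition _ := GRing.isLinear.Build A _ _ _ tens_fun tens_fun_linear.

Lemma tens_funE v c : tens_fun (bl t v c) = (g v : A) *: c.
Proof.
apply: (tens_extE (basisP i) (h := fun v c => (g v : A) *: c)).
  by move=> c' a u v'; rewrite linearP scalerDl -scalerA.
by move=> v' a c' c''; rewrite scalerDr !scalerA mulrC.
Qed.

Lemma tens_fun_in_m w : (forall v, (g v : A) \in m) -> in_mV (tens_fun w).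
Proof. by move=> gm; apply: in_mV_sum => b; exact: in_mVZ. Qed.

End Functional.

Lemma tens_fun_df i (g : {linear M i -> A^o}) (w : X i.+1) :
  tens_fun g (df w) = tens_fun (g \o df) w.
Proof.
rewrite /= /tens_df [in LHS]/tens_ext /fs_ext linear_sum.
by apply: eq_bigr => b _; exact: tens_funE.
Qed.

Let kX := fun Ns => kos (pow_seq xs Ns) X.

Let X_exact Ns : size Ns = size xs -> exact_pos (kX Ns).
Proof.
move=> sz_Ns; apply: kos_exact_pos => [i|i v]; last first.
  rewrite size_pow_seq // => lt_i; apply: basis_of_trivial (basisP i) _ => u.
  exact: M_big.
apply: wreg_pow; first by split=> [|u v -> ->|a u ->]; rewrite ?addr0 ?scaler0.
have subC : is_submod (fun c : C => c = 0).
  by split=> [|u v -> ->|a u ->]; rewrite ?addr0 ?scaler0.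
apply: eq_wreg (fs_wreg _ subC C_reg) => w.
by split=> [w0|-> //]; apply: fsP.
Qed.

Let lift : exists2 Ns, size Ns = size xs &
  exists (p : kos (pow_seq xs Ns) M 0%N) (s : 'I_n -> kos (pow_seq xs Ns) M 1%N),
  [/\ kos_ev p = e, forall l, kos_ev (s l) = f l & forall l, df (s l) = y l *: p].
Proof.
by apply: kos_lift => // x /xs_m; [exact: m_gen|exact: nilM].
Qed.

Lemma relations_in_m (c : 'I_n -> C) :
  \sum_l y l *: c l = 0 -> forall l, in_mV (c l).
Proof.
move=> yc0 l; have [Ns sz_Ns [p [s [evp evs ds]]]] := lift.
pose tK := kos_bilin (pow_seq xs Ns) t.
(* The sum of the s_j (x) c_j is a cycle: its boundary is p (x) (sum y_j c_j) = 0. *)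
have [|w Ew] := X_exact sz_Ns (z := \sum_j bl tK (s j) (c j)).
  rewrite linear_sum /= -[RHS](linear0 (bl tK p)) -yc0 linear_sum.
  by apply: eq_bigr => j _; rewrite bl_df ds blZl linearZ_LR.
have {w Ew}[w Ew] : exists w : X 2%N, \sum_j bl t (f j) (c j) = df w.
  exists (kos_ev w); rewrite -kos_ev_df -Ew linear_sum; apply: eq_bigr => j _.
  by rewrite /= kos_ev_bilin evs.
(* As r d has values in m, it lifts through h to some g : M_1 -> A^n with sum y_l g_l = r d. *)
pose h (a : 'I_n -> A^o) : A^o := \sum_l y l * a l.
have h_lin : linear h.
  move=> a u v; rewrite /h scaler_sumr -big_split; apply: eq_bigr => j _.
  by rewrite /= mulrDr; congr (_ + _); rewrite mulrCA.
pose hL := HB.pack_for {linear ('I_n -> A^o) -> A^o} h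
  (GRing.isLinear.Build A _ _ _ h h_lin).
have [|g hg] := @free_lift A _ _ _ hL (r \o df) (ex_intro _ _ (basisP 1)).
  move=> v; have [a Ea] := m_gen (r_df v); exists a; rewrite /= Ea.
  by apply: eq_bigr => j _; rewrite mulrC.
pose gl (v : M 1%N) : A^o := g v l.
have gl_lin : linear gl by move=> a u v; rewrite /gl linearP.
pose glL := HB.pack_for {linear M 1%N -> A^o} gl
  (GRing.isLinear.Build A _ _ _ gl gl_lin).
(* By [y_min], since sum y_l g_l vanishes on boundaries. *)
have gl_df (v : M 2%N) : (gl (df v) : A) \in m.
  apply: (y_min (a := g (df v))); transitivity (hL (g (df v)) : A).
    by apply: eq_bigr => j _; rewrite mulrC.
  by rewrite hg /= dfdf linear0.
(* Again by [y_min]: sum y_k g_k(f_j) = r(d f_j) = y_j r(e), and r(e) is 1 modulo m. *)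
have gl_f j : (gl (f j) : A) - (l == j)%:R \in m.
  have Ha : gl (f j) - (l == j)%:R * r e \in m.
    apply: (y_min (a := fun l => g (f j) l - (l == j)%:R * r e)).
    rewrite (eq_bigr _ (fun k _ => mulrBl _ _ _)) sumrB; apply/eqP.
    rewrite subr_eq0; apply/eqP; transitivity (hL (g (f j)) : A).
      by apply: eq_bigr => k _; rewrite mulrC.
    rewrite hg /= df_f linearZ_LR (bigD1 j) //= eqxx mul1r big1 ?addr0.
      by rewrite mulrC.
    by move=> k /negPf ->; rewrite !mul0r.
  rewrite -(subrK ((l == j)%:R * r e) (gl (f j))) -addrA rpredD //.
  by rewrite -[X in _ - X]mulr1 -mulrBr idealMr.
have [V0 VD VZ] := in_mV_submod C.
have : in_mV (tens_fun glL (df w)) by rewrite tens_fun_df; exact: tens_fun_in_m.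
rewrite -Ew linear_sum => Hsum.
(* The first sum is the image under g_l (x) C of the boundary dw, hence in mC; the second has
   coefficients in m. *)
have -> : c l = \sum_j tens_fun glL (bl t (f j) (c j))
              - \sum_j (gl (f j) - (l == j)%:R) *: c j.
  rewrite -sumrB (bigD1 l) //= tens_funE eqxx /= -scalerBl subKr.
  rewrite scale1r big1 ?addr0 // => j; rewrite eq_sym => /negPf jl.
  by rewrite tens_funE jl subr0 subrr.
apply: (is_submodB (in_mV_submod C) Hsum).
by apply: in_mV_sum => j; exact: in_mVZ.
Qed.

Theorem embedding_dim_le (c0 : C) : ~ in_mV c0 -> (n <= size xs)%N.
Proof.
move=> c0P; rewrite leqNgt; apply/negP => lt_n.
have [Ns sz_Ns [p [s [evp evs ds]]]] := lift.
pose tK := kos_bilin (pow_seq xs Ns) t.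
have dt l : df (bl tK (s l) c0) = y l *: bl tK p c0.
  by rewrite bl_df ds blZl.
have [P [P0 PS]] := koszul_ladder (enum_uniq 'I_n) (X_exact sz_Ns) dt.
(* The value of P_j vanishes modulo (y)X and boundaries. This holds at n, where X_n = 0, descends
   one degree at a time, and fails at 0. *)
pose bad j := exists (u : 'I_n -> X j) (w : X j.+1),
  kos_ev (P j) = \sum_i y i *: u i + df w.
have badS j : (j < n)%N -> bad j.+1 -> bad j.
  move=> lt_j [u [w Euw]]; pose l := Ordinal lt_j.
  have [|c [v [cc vl dP]]] := PS j l _ (nth_ord_enum _ l).
    by rewrite size_enum_ord.
  have := congr1 df Euw; rewrite -kos_ev_df dP [RHS]linearD dfdf addr0.
  rewrite [LHS]linearD linearZ_LR !linear_sum /= => /eqP; rewrite -subr_eq0.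
  (* Applying d to the equation for P_(j+1) leaves the relation sum y_i z_i = 0 on X, so
     [relations_in_m] puts z_l in (y)X. *)
  pose z i := (c * (i == l)%:R) *: kos_ev (P j) + kos_ev (v i) - df (u i).
  have -> : (c * y l) *: kos_ev (P j) + \sum_i kos_ev (y i *: v i)
            - \sum_i df (y i *: u i) = \sum_i y i *: z i.
    under [RHS]eq_bigr do rewrite /z scalerBr scalerDr.
    rewrite sumrB big_split /= -!addrA; congr (_ + _).
      rewrite (bigD1 l) //= eqxx mulr1 scalerA mulrC big1 ?addr0 // => i.
      by move=> /negPf ->; rewrite mulr0 scale0r scaler0.
    by congr (_ - _); apply: eq_bigr => i _; rewrite linearZ_LR.
  move=> /eqP/(fs_relations relations_in_m)/(_ l)[u' Eu'].
  (* As v_l = 0 and c * c = 1, multiplying z_l by c isolates P_j, with d(c u_l) as boundary term. *)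
  exists (fun i => c *: u' i), (c *: u l).
  rewrite linearZ_LR (eq_bigr (fun i => c *: (y i *: u' i))); last first.
    by move=> i _; rewrite !scalerA mulrC.
  rewrite -scaler_sumr -Eu' -scalerDr /z subrK eqxx mulr1 vl linear0 addr0.
  by rewrite scalerA cc scale1r.
have bad0 j : (j <= n)%N -> bad j -> bad 0%N.
  by elim: j => [|j IH] // lt_j /(badS _ lt_j)/IH; apply; exact: ltnW.
have bad_n : bad n.
  exists (fun=> 0), 0; apply: (etrans (y := 0)).
    by apply: basis_of_trivial (basisP n) _ => u; exact: M_big.
  by rewrite linear0 addr0 big1 // => i _; rewrite scaler0.
have [u [w]] := bad0 n (leqnn n) bad_n; rewrite P0 kos_ev_bilin evp.
(* The map r (x) C sends e (x) c0 to c0 modulo mC and boundaries into mC. *)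
move=> /(congr1 (tens_fun r)); rewrite tens_funE [RHS]linearD linear_sum.
move=> Ec0; apply: c0P; have [V0 VD VZ] := in_mV_submod C.
have -> : c0 = (r e : A) *: c0 - ((r e : A) - 1) *: c0.
  by rewrite -scalerBl subKr scale1r.
apply: (is_submodB (in_mV_submod C)); last exact: in_mVZ.
rewrite Ec0; apply: VD; last first.
  rewrite -[X in in_mV X]/(tens_fun r (df w)) tens_fun_df.
  exact: tens_fun_in_m.
by exists (fun i => tens_fun r (u i)); apply: eq_bigr => i _; rewrite linearZ_LR.
Qed.

End EmbeddingDimension.

(** * Local rings *)

Section LocalRingFacts.
Variables (A : comNzRingType) (m : idealr A).

(** Zorn's lemma, in preorder form so that equality of ideals as records never comes up. *)
Lemma proper_sub_maximal (I : idealr A) :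
  exists2 J : idealr A, maximal_ideal J & {subset I <= J}.
Proof.
pose T := {J : idealr A | `[< {subset I <= J} >]}.
pose R (s t : T) := `[< {subset val s <= val t} >].
have t0 : T by exists I; apply/asboolP.
have [||F totF|t tmax] := @ZL_preorder T t0 R.
- by move=> t; apply/asboolP.
- by move=> r s t /asboolP rs /asboolP st; apply/asboolP => a /rs/st.
(* The union of an empty chain would not contain 0; [t0] bounds that chain instead. *)
- have [[s0 Fs0]|F0] := pselect (exists s, F s); last first.
    by exists t0 => s Fs; case: F0; exists s.
  pose U : {pred A} := fun a => `[< exists2 s, F s & a \in val s >].
  have U_closed : idealr_closed U.
    split.
    - by apply/asboolP; exists s0 => //; exact: rpred0.
    - by apply/negP => /asboolP[s _]; rewrite idealr1.
    move=> a u v /asboolP[s Fs us] /asboolP[t Ft vt]; apply/asboolP.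
    have [/asboolP st|/asboolP ts] := totF _ _ Fs Ft; [exists t|exists s] => //.
      by apply: rpredD => //; apply: idealMr; exact: st.
    by apply: rpredD (ts _ vt); exact: idealMr.
  pose UI := HB.pack_for (idealr A) U (isIdealr.Build A U U_closed).
  have IU : {subset I <= UI}.
    by move=> a Ia; apply/asboolP; exists s0 => //; exact: (asboolW (valP s0)).
  exists (exist _ UI (asboolT IU) : T) => s Fs; apply/asboolP => a sa.
  by apply/asboolP; exists s.
exists (val t) => [J tJ|]; last exact: (asboolW (valP t)).
have IJ : {subset I <= J} by move=> a /(asboolW (valP t))/tJ.
have /asboolP Jt := tmax (exist _ J (asboolT IJ)) (asboolT tJ).
by move=> a; apply/idP/idP; [exact: Jt|exact: tJ].
Qed.

Hypothesis A_local : local_ring m.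

(** A non-unit generates a proper ideal, and the maximal ideal above it must be m. *)
Lemma local_unit a : a \notin m -> exists b, b * a = 1.
Proof.
move=> am; apply: contrapT => a_nonunit.
pose I : {pred A} := fun x => `[< exists b, x = b * a >].
have I_closed : idealr_closed I.
  split.
  - by apply/asboolP; exists 0; rewrite mul0r.
  - by apply/negP => /asboolP[b ab]; apply: a_nonunit; exists b.
  move=> c u v /asboolP[b ->] /asboolP[b' ->]; apply/asboolP.
  by exists (c * b + b'); rewrite mulrDl mulrA.
have [J Jmax IJ] :=
  proper_sub_maximal (HB.pack_for (idealr A) I (isIdealr.Build A I I_closed)).
case/negP: am; rewrite -(A_local.2 J Jmax); apply: IJ.
by apply/asboolP; exists 1; rewrite mul1r.
Qed.

(** If x^N v <> 0, the modules A x^j v for j from N + 1 down to 0 form a strict chain exceeding the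
    length bound N: x^j v = a x^(j+1) v forces x^j v = 0, because 1 - a x is a unit. *)
Lemma finite_length_nilp (V : lmodType A) x :
  finite_length V -> x \in m -> exists N, forall v : V, x ^+ N *: v = 0.
Proof.
move=> [N lenV] xm; exists N => v; apply: contrapT => xv.
have stable j a : x ^+ j *: v = a *: (x ^+ j.+1 *: v) -> x ^+ j *: v = 0.
  move=> E; have [b ba] : exists b, b * (1 - a * x) = 1.
    apply: local_unit; apply/negP => H.
    by have := idealr1 m; rewrite -(subrK (a * x) 1) rpredD ?idealMr.
  have E' : (1 - a * x) *: (x ^+ j *: v) = 0.
    by rewrite scalerBl scale1r {1}E exprS !scalerA -mulrA subrr.
  by rewrite -[LHS]scale1r -ba -scalerA E' scaler0.
pose cyc (u : V) : {pred V} := fun w => `[< exists a, w = a *: u >].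
have cyc_closed u : subsemimod_closed (cyc u).
  split; first split; rewrite ?unfold_in.
  - by apply/asboolP; exists 0; rewrite scale0r.
  - move=> _ _ /asboolP[a ->] /asboolP[b ->]; apply/asboolP; exists (a + b).
    by rewrite scalerDl.
  by move=> c _ /asboolP[a ->]; apply/asboolP; exists (c * a); rewrite scalerA.
pose S i : submodClosed V := HB.pack_for (submodClosed V)
  (cyc (x ^+ (N.+1 - i) *: v))
  (GRing.isSubmodClosed.Build A V _ (cyc_closed (x ^+ (N.+1 - i) *: v))).
suff /lenV : strict_chain N.+1 S by rewrite ltnn.
move=> i lt_i; have Ei : (N.+1 - i = (N.+1 - i.+1).+1)%N by rewrite subnSK.
split=> [w /asboolP[a ->]|]; first apply/asboolP.
  by exists (a * x); rewrite Ei exprS !scalerA mulrA.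
exists (x ^+ (N.+1 - i.+1) *: v); first by apply/asboolP; exists 1; rewrite scale1r.
apply/negP => /asboolP[a]; rewrite Ei => /stable E; apply: xv.
by rewrite subSS in E; rewrite -(subnK (leq_subr i N)) exprD -scalerA E scaler0.
Qed.

(** For n least, a relation with a unit coefficient would express one generator through the
    others. *)
Lemma minimal_generators : noetherian A ->
  exists n (y : 'I_n -> A),
  (forall a, a \in m <-> exists c, a = \sum_l c l * y l) /\
  (forall a : 'I_n -> A, \sum_l a l * y l = 0 -> forall l, a l \in m).
Proof.
move=> noeth.
pose P n := `[< exists y : 'I_n -> A,
  forall a, a \in m <-> exists c, a = \sum_l c l * y l >].
have exP : exists n, P n.
  have [xs xsP] := noeth (GRing.SubmodClosed.clone A A^o (ideal_pred m) _).
  exists (size xs); apply/asboolP; exists (fun i => xs`_i) => a.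
  exact: xsP.
case: (ex_minnP exP) => n /asboolP[y yP] n_min; exists n, y; split=> // a Ea l.
apply: contrapT => /negP/local_unit[b ba].
case: n y yP n_min a Ea l ba => [|n] y yP n_min a Ea l ba; first by case: l {ba}.
suff /n_min : P n by rewrite ltnn.
have Ey : y l = \sum_j (- (b * a (lift l j))) * y (lift l j).
  rewrite (bigD1_ord l) //= in Ea; apply/eqP.
  rewrite -[y l]mul1r -ba -mulrA -subr_eq0 -sumrN.
  rewrite (eq_bigr (fun j => b * (a (lift l j) * y (lift l j)))); last first.
    by move=> j _; rewrite mulNr opprK mulrA.
  by rewrite -mulr_sumr -mulrDr Ea mulr0.
apply/asboolP; exists (fun j => y (lift l j)) => c; split=> [/yP[u ->]|[u ->]].
  exists (fun j => u (lift l j) - u l * (b * a (lift l j))).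
  rewrite (bigD1_ord l) //= {1}Ey mulr_sumr -big_split /=.
  by apply: eq_bigr => j _; rewrite mulrDl addrC mulrA mulrN.
apply: rpred_sum => j _; apply: idealMr; apply/yP.
exact: sum_delta.
Qed.

End LocalRingFacts.

(** * Quotient maps as linear maps *)

Section QuotientProjection.
Local Open Scope quotient_scope.
Variables (A : pzRingType) (V : lmodType A) (S : submodClosed V).

Definition quot_pi (v : V) : modquot S := \pi_(modquot S) v.

Lemma quot_pi_linear : linear quot_pi.
Proof. by move=> a u v; rewrite /quot_pi pi_modquotD pi_modquotZ. Qed.

HB.instance Definition _ := GRing.isLinear.Build A _ _ _ quot_pi quot_pi_linear.

Lemma quot_pi_eq0 v : (quot_pi v == 0) = (v \in S).
Proof. by rewrite -[0](linear0 quot_pi) modquot_eqP subr0. Qed.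

Lemma quot_pi_surj q : exists v, quot_pi v = q.
Proof. by exists (repr q); exact: reprK. Qed.

End QuotientProjection.

(** * Regular sequences on a big Cohen-Macaulay module *)

Section BigCohenMacaulay.
Variables (A : comNzRingType) (C : lmodType A).
Implicit Types (x : A) (xs zs : seq A).

Lemma ext_predP xs (c : C) : reflect
  (exists v : nat -> C, c = \sum_(0 <= i < size xs) xs`_i *: v i)
  (c \in ext_pred xs).
Proof.
apply: (iffP (asboolP _)) => [[v ->]|[v ->]]; last first.
  by exists (fun i => v i); rewrite big_mkord.
exists (fun i => if insub i is Some o then v o else 0); rewrite big_mkord.
by apply: eq_bigr => i _; rewrite valK.
Qed.

Lemma ext_pred_rcons xs x (c : C) :
  c \in ext_pred (rcons xs x) <-> adjoin (fun c => c \in ext_pred xs) x c.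
Proof.
have sumE (v : nat -> C) : \sum_(0 <= i < size (rcons xs x)) (rcons xs x)`_i *: v i
    = \sum_(0 <= i < size xs) xs`_i *: v i + x *: v (size xs).
  rewrite size_rcons big_nat_recr //= nth_rcons ltnn eqxx; congr (_ + _).
  by apply: eq_big_nat => i /andP[_ lt_i]; rewrite nth_rcons lt_i.
split=> [/ext_predP[v ->]|[s [w [/ext_predP[v ->] ->]]]].
  rewrite sumE; exists (\sum_(0 <= i < size xs) xs`_i *: v i), (v (size xs)).
  by split=> //; apply/ext_predP; exists v.
apply/ext_predP; exists (fun i => if (i < size xs)%N then v i else w).
rewrite sumE ltnn; congr (_ + _).
by apply: eq_big_nat => i /andP[_ ->].
Qed.

Lemma regular_sequence_wreg xs :
  regular_sequence C xs -> wreg (fun c : C => c = 0) xs.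
Proof.
move=> [_ reg].
(* Induction on the number k of remaining elements: [regular_sequence] speaks of prefixes, while
   [wreg] consumes the sequence from the front. *)
suff H k : (k <= size xs)%N ->
    wreg (fun c : C => c \in ext_pred (take (size xs - k) xs))
      (drop (size xs - k) xs).
  have := H (size xs) (leqnn _); rewrite subnn take0 drop0; apply: eq_wreg => c.
  split=> [/ext_predP[v ->]|->]; last exact: rpred0.
  by rewrite big_geq.
elim: k => [|k IH] lt_k; first by rewrite subn0 drop_size.
have lt_i : (size xs - k.+1 < size xs)%N by rewrite ltn_subrL /= (leq_trans _ lt_k).
move: IH; rewrite -(subnSK lt_k) => /(_ (ltnW lt_k)).
move: (size xs - k.+1)%N lt_i => i lt_i IH; rewrite (drop_nth 0 lt_i) /=; split.
  move=> c xc; have := reg i lt_i (quot_pi _ c).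
  rewrite -linearZ_LR => h; apply/idP; rewrite -quot_pi_eq0; apply/eqP/h/eqP.
  by rewrite quot_pi_eq0.
apply: eq_wreg IH => c; rewrite (take_nth 0 lt_i); exact: ext_pred_rcons.
Qed.

Fixpoint adjoins (S : C -> Prop) zs :=
  if zs is z :: zs' then adjoins (adjoin S z) zs' else S.

(** A Nakayama lemma for nilpotent actions, without finite generation: substituting C = S + zC into
    itself gives C = S + z^k C for every k. *)
Lemma adjoins_full (S : C -> Prop) zs : is_submod S ->
  (forall z, z \in zs -> exists N, forall c, S (z ^+ N *: c)) ->
  (forall c, adjoins S zs c) -> forall c, S c.
Proof.
elim: zs S => [|z zs IH] S subS nil full //=; have [S0 SD SZ] := subS.
have full_z : forall c, adjoin S z c.
  apply: IH full; first exact: is_submod_adjoin.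
  move=> z' zs_z'; have [|N zN] := nil z'; first by rewrite inE zs_z' orbT.
  by exists N => c; exists (z' ^+ N *: c), 0; rewrite scaler0 addr0.
have full_pow k c : adjoin S (z ^+ k) c.
  elim: k c => [|k IHk] c; first by exists 0, c; rewrite scale1r add0r.
  have [s [w [Ss ->]]] := IHk c; have [s' [w' [Ss' ->]]] := full_z w.
  exists (s + z ^+ k *: s'), w'; split; first by apply: SD => //; exact: SZ.
  by rewrite scalerDr scalerA -exprSr addrA.
have [N zN] := nil z (mem_head _ _).
by move=> c; have [s [w [Ss ->]]] := full_pow N c; exact: SD.
Qed.

Lemma adjoins_mem (S : C -> Prop) zs : is_submod S ->
  [/\ is_submod (adjoins S zs), forall c, S c -> adjoins S zs c
    & forall z c, z \in zs -> adjoins S zs (z *: c)].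
Proof.
elim: zs S => [|z zs IH] S subS //=; have [S0 _ _] := subS.
have [sub_adj S_adj zs_adj] := IH _ (is_submod_adjoin z subS).
split=> // [c Sc|z' c]; first by apply: S_adj; exists c, 0; rewrite scaler0 addr0.
rewrite inE => /predU1P[->|]; last exact: zs_adj.
by apply: S_adj; exists 0, c; rewrite add0r.
Qed.

(** A power of each y_l lies in (xs), so y_l is nilpotent on C/(xs)C; if (y)C were C, [adjoins_full]
    would give (xs)C = C. *)
Lemma exists_not_in_mV (m : idealr A) n (y : 'I_n -> A) xs :
  (forall l, y l \in m) -> system_of_parameters m xs ->
  (exists c : C, c \notin ext_pred xs) -> exists c : C, ~ in_mV y c.
Proof.
move=> ym [_ _ pow_xs] [c cxs]; apply: contrapT => all_mV; case/negP: cxs.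
have subE : is_submod (fun c : C => c \in ext_pred xs).
  by split=> [|u v|a u]; [exact: rpred0|exact: rpredD|exact: rpredZ].
pose zs := [seq y l | l <- enum 'I_n].
apply: (@adjoins_full (fun c : C => c \in ext_pred xs) zs subE).
  move=> _ /mapP[l _ ->].
  have [N [a Ea]] := pow_xs _ (ym l); exists N => c'; apply/asboolP.
  exists (fun i => a i *: c'); rewrite Ea scaler_suml; apply: eq_bigr => i _.
  by rewrite scalerA mulrC.
move=> c'; have [u ->] : in_mV y c' by apply: contrapT => h; apply: all_mV; exists c'.
have [[E0 ED _] _ E_zs] := adjoins_mem zs subE.
apply: big_ind => // l _; apply: E_zs.
by apply: map_f; rewrite mem_enum.
Qed.

End BigCohenMacaulay.

(** * Homology, and the residue field as a summand of it *)

Section KerModIm.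
Variables (A : comNzRingType) (m : idealr A) (U V W : lmodType A).
Variables (f : {linear U -> V}) (g : {linear V -> W}).

Lemma ker_mod_im_nilp x : local_ring m -> finite_length (ker_mod_im f g) ->
  x \in m -> exists N, forall z, g z = 0 -> exists u, x ^+ N *: z = f u.
Proof.
move=> A_local lenH xm; have [N xN] := finite_length_nilp A_local lenH xm.
exists N => z gz; have kz : z \in ker_pred g by apply/eqP.
have /eqP := xN (quot_pi _ (Cycle kz)); rewrite -linearZ_LR quot_pi_eq0.
by move=> /asboolP[u fu]; exists u; rewrite fu.
Qed.

Hypothesis g0 : forall v, g v = 0.

Let ker_full v : v \in ker_pred g. Proof. exact/eqP/g0. Qed.

Definition ker_class (v : V) : ker_mod_im f g := quot_pi _ (Cycle (ker_full v)).

Lemma ker_class_linear : linear ker_class.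
Proof.
by move=> a u v; rewrite /ker_class -linearP; congr quot_pi; exact: val_inj.
Qed.

HB.instance Definition _ := GRing.isLinear.Build A _ _ _ ker_class ker_class_linear.

Lemma ker_class_eq0 v : ker_class v = 0 <-> exists u, f u = v.
Proof.
split=> [/eqP|fu]; first by rewrite quot_pi_eq0 => /asboolP.
by apply/eqP; rewrite quot_pi_eq0; exact/asboolP.
Qed.

Lemma ker_class_surj h : exists v, ker_class v = h.
Proof.
have [[v kv] <-] := quot_pi_surj h; exists v.
by congr quot_pi; exact: val_inj.
Qed.

(** Here e lifts the generator of the summand k, the f_l exist because m kills that generator, and r
    lifts V -> k through A -> k by freeness of V. *)
Lemma residue_summand n (y : 'I_n -> A) :
  is_free V -> (forall l, y l \in m) ->
  direct_summand (residue_field m) (ker_mod_im f g) ->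
  exists (e : V) (fl : 'I_n -> U) (r : {linear V -> A^o}),
  [/\ forall l, f (fl l) = y l *: e, (r e : A) - 1 \in m
    & forall u, (r (f u) : A) \in m].
Proof.
move=> V_free ym [N [phi [psi phiK psiK]]].
pose p : {linear A^o -> residue_field m} :=
  quot_pi (GRing.SubmodClosed.clone A A^o (ideal_pred m) _).
have p_eq0 a : (p a == 0) = (a \in m) by exact: quot_pi_eq0.
have [e Ee] := ker_class_surj (phi (p 1, 0)).
have psi_lin : linear psi.
  by move=> a u v; apply: (can_inj phiK); rewrite psiK linearP !psiK.
pose q v : residue_field m := (psi (ker_class v)).1.
have q_lin : linear q by move=> a u v; rewrite /q linearP psi_lin.
pose qL := HB.pack_for {linear V -> residue_field m} q
  (GRing.isLinear.Build A _ _ _ q q_lin).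
have yp l : y l *: p 1 = 0.
  by apply/eqP; rewrite -linearZ_LR p_eq0; have := ym l; rewrite -{1}[y l]mulr1.
have /choice[fl Efl] l : exists u, f u = y l *: e.
  apply/ker_class_eq0; rewrite linearZ_LR /= Ee -linearZ_LR -[RHS](linear0 phi).
  by congr (phi _); congr (_, _); [exact: yp|exact: scaler0].
have [v|r Er] := free_lift (p := p) (q := qL) V_free; first exact: quot_pi_surj.
exists e, fl, r; split=> // [|u].
  by rewrite -p_eq0 linearB Er /= /q Ee phiK subrr.
rewrite -p_eq0; have fu0 : ker_class (f u) = 0 by apply/ker_class_eq0; exists u.
have psi0 : psi 0 = 0 by apply: (can_inj phiK); rewrite psiK linear0.
by rewrite Er /= /q fu0 psi0.
Qed.

End KerModIm.

(** * Regularity from a bound on the number of generators *)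

Lemma lin_comb_submod (A : comNzRingType) (V : lmodType A) (vs : seq V) :
  is_submod (lin_comb vs).
Proof.
split.
- by exists (fun=> 0); rewrite big1 // => i _; rewrite scale0r.
- move=> _ _ [a ->] [b ->]; exists (fun i => a i + b i); rewrite -big_split.
  by apply: eq_bigr => i _; rewrite scalerDl.
by move=> a _ [b ->]; exists (fun i => a * b i); rewrite scaler_sumr;
  apply: eq_bigr => i _; rewrite scalerA.
Qed.

Lemma lin_comb_mem (A : comNzRingType) (V : lmodType A) (vs : seq V) v :
  v \in vs -> lin_comb vs v.
Proof.
rewrite -index_mem => lt_v; exists (fun i => (i == Ordinal lt_v)%:R).
rewrite (bigD1 (Ordinal lt_v)) //= eqxx scale1r nth_index -?index_mem //.
by rewrite big1 ?addr0 // => i /negPf ->; rewrite scale0r.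
Qed.

Lemma krull_dim_uniq (A : comNzRingType) d d' :
  krull_dim A d -> krull_dim A d' -> d = d'.
Proof.
move=> [[P Pd] dmax] [[P' Pd'] dmax']; apply/eqP; rewrite eqn_leq.
by rewrite (dmax' _ _ Pd) (dmax _ _ Pd').
Qed.

(** [regular_local] asks for exactly d generators, so zeros pad the list. *)
Lemma regular_of_few_generators (A : comNzRingType) (m : idealr A) d n
    (y : 'I_n -> A) : krull_dim A d -> (n <= d)%N ->
  (forall a, a \in m <-> exists c, a = \sum_l c l * y l) -> regular_local m.
Proof.
move=> dimA le_nd yP.
have ym l : y l \in m by apply/yP; exact: sum_delta.
exists ([seq y l | l <- enum 'I_n] ++ nseq (d - n) 0).
rewrite size_cat size_map size_enum_ord size_nseq subnKC //; split=> // a.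
set xs := _ ++ _; have [G0 GD GZ] := lin_comb_submod (xs : seq A^o).
split=> [/yP[c ->]|[c ->]].
  apply: (@big_ind A (gen_ideal xs)) => // l _; apply: GZ; apply: lin_comb_mem.
  by rewrite mem_cat map_f // mem_enum.
apply: rpred_sum => i _; apply: idealMr.
have /(mem_nth 0) := ltn_ord i; rewrite mem_cat => /orP[/mapP[l _ ->] //|].
by rewrite mem_nseq => /andP[_ /eqP ->]; exact: rpred0.
Qed.

Definition nonneg_chain (A : comNzRingType) (M : complex A) : chain A :=
  @Chain A (fun i => M i%:Z) (fun i => diff M i.+1%:Z i%:Z)
    (fun i x => diff_diff (c := M) _ _ x).

Theorem theorem2p4 (A : comNzRingType) (m : idealr A)
  (A_noeth : noetherian A) (A_local : local_ring m)
  (d : nat) (dimA : krull_dim A d)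
  (M : complex A)
  (M_free : forall i, is_free (M i))
  (M_bounded : forall i : int, ~~ (0 <= i <= d%:Z) -> forall x : M i, x = 0)
  (H0_fg : fin_gen (homology M 0))
  (Hi_length : forall i : int, 1 <= i -> finite_length (homology M i))
  (A_bigCM : exists C : lmodType A, big_cohen_macaulay m C)
  (k_summand : direct_summand (residue_field m) (homology M 0)) :
  regular_local m.
Proof.
have [n [y [yP y_min]]] := minimal_generators A_local A_noeth.
have ym l : y l \in m by apply/yP; exact: sum_delta.
have [C [xs [sop_xs reg_xs]]] := A_bigCM.
have [dim_xs xs_m _] := sop_xs; have Ed := krull_dim_uniq dimA dim_xs.
apply: (regular_of_few_generators dimA _ yP); rewrite Ed.
pose basis (i : nat) := sval (cid (M_free i%:Z)).
have basisP i : is_basis (basis i) by exact: (svalP (cid (M_free i%:Z))).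
(* M vanishes in degree -1, so all of M_0 consists of cycles. *)
have d0 (v : M 0) : diff M 0 (0 - 1) v = 0 by apply: M_bounded.
have [e [f [r [df_f r_e r_df]]]] := residue_summand d0 (M_free 0) ym k_summand.
have nilM x : x \in m -> nilp_homology (nonneg_chain M) x.
  move=> xm i; have := Hi_length i.+1%:Z isT; rewrite /homology.
  have -> : i.+1%:Z + 1 = i.+2%:Z by rewrite -PoszD addn1.
  have -> : i.+1%:Z - 1 = i%:Z by rewrite intS addrC addKr.
  by move=> /(ker_mod_im_nilp A_local)/(_ xm).
have M_big i (v : nonneg_chain M i) : (size xs < i)%N -> v = 0.
  by move=> lt_i; apply: M_bounded; rewrite negb_and Ed lez_nat -ltnNge lt_i orbT.
have [c0 c0P] := exists_not_in_mV ym sop_xs reg_xs.1.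
apply: (embedding_dim_le (M := nonneg_chain M) (basis := basis) _ y_min _
  df_f r_e r_df nilM _ (regular_sequence_wreg reg_xs) _ c0P) => //.
by move=> a /yP.
Qed.
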